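(* Let $Q=\{Q_0(x),\dots,Q_{n-1}(x)\}$, $\deg Q_k=k$, be a system of well-free polynomials satisfying $$Q_k(x)=(\alpha_kx-\delta_k)Q_{k-1}(x)-(\beta_kx+\gamma_k)Q_{k-2}(x),\qquad k=1,\dots,n-1,$$ where for $k=1$ the last term is absent, i.e. $Q_1(x)=(\alpha_1x-\delta_1)Q_0(x)$. Then the columns $\mathbf{s}_k$ of $S_{PQ}$ satisfy $$\mathbf{s}_2=(\alpha_1Z_0-\delta_1I)\mathbf{s}_1,$$ $$\mathbf{s}_{k+1}=(\alpha_kZ_0-\delta_kI)\mathbf{s}_k-(\beta_kZ_0+\gamma_kI)\mathbf{s}_{k-1},\qquad k=2,\dots,n-1,$$ where $Z_0$ is the $n\times n$ lower shift matrix. As a consequence, all entries of $S_{PQ}$ can be computed in $\mathcal{O}(n^2)$ operations.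
   Context: $S_{PQ}$ is the $n\times n$ basis transformation matrix from $Q$ to the monomial basis $P=\{1,x,\dots,x^{n-1}\}$: its $j$-th column $\mathbf{s}_j$ contains the coefficients of $Q_{j-1}$, i.e. $Q_{j-1}(x)=\sum_{i=1}^n[S_{PQ}]_{ij}x^{i-1}$. $Z_0$ has ones on the first subdiagonal and zeros elsewhere. Operations are arithmetic operations over $\mathbb{C}$; the recurrence coefficients and $Q_0$ are given. *)

(* Defs.v *)
From HB Require Import structures.
From mathcomp Require Import all_boot all_order all_algebra.
From mathcomp Require Import reals complex.

Set Implicit Arguments.
Unset Strict Implicit.
Unset Printing Implicit Defensive.

Import GRing.Theory.
Local Open Scope ring_scope.

Section Polynomials.
Variable F : fieldType.

(* Only alpha, delta at indices 1, ..., n-1, beta, gamma at indices 2, ..., n-1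
   and Q at indices 0, ..., n-1 are relevant: the values of these functions at
   other indices are unconstrained and unused.  The degree condition forces
   alpha k != 0 for 1 <= k < n. *)
Definition well_free (n : nat) (alpha beta gamma delta : nat -> F)
    (Q : nat -> {poly F}) : Prop :=
  [/\ forall k, (k < n)%N -> size (Q k) = k.+1,
      (1 < n)%N -> Q 1%N = (alpha 1%N *: 'X - (delta 1%N)%:P) * Q 0%N
    & forall k, (2 <= k < n)%N ->
        Q k = (alpha k *: 'X - (delta k)%:P) * Q k.-1
              - (beta k *: 'X + (gamma k)%:P) * Q k.-2].

(* Rows and columns are numbered from 0: column j holds the coefficients of
   Q j, i.e. it is the vector usually written s_(j+1). *)
Definition S_PQ (n : nat) (Q : nat -> {poly F}) : 'M[F]_n :=
  \matrix_(i < n, j < n) (Q j)`_i.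

Definition Z0 (n : nat) : 'M[F]_n :=
  \matrix_(i < n, j < n) (i == j.+1 :> nat)%:R.

End Polynomials.

(* Straight-line programs over F.  The memory is a sequence of field elements,
   initially the inputs; each instruction appends one value.  Execution fails
   (None) on a division by zero or on a read outside the memory. *)
Section StraightLinePrograms.
Variable F : fieldType.

Inductive arith_op := Add | Sub | Mul | Div.

Inductive instr :=
  | Const of F
  | Arith of arith_op & nat & nat.

Definition apply_op (o : arith_op) (x y : F) : option F :=
  match o with
  | Add => Some (x + y)
  | Sub => Some (x - y)
  | Mul => Some (x * y)
  | Div => if y == 0 then None else Some (x / y)
  end.

Definition exec (mem : seq F) (op : instr) : option F :=
  match op with
  | Const c => Some c
  | Arith o a b =>
      match onth mem a, onth mem b with
      | Some x, Some y => apply_op o x y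
      | _, _ => None
      end
  end.

Fixpoint run (prog : seq instr) (mem : seq F) : option (seq F) :=
  if prog is op :: prog' then
    if exec mem op is Some v then run prog' (rcons mem v) else None
  else Some mem.

(* Constants are charged as well, so this bounds from above the number of
   arithmetic operations. *)
Definition op_count (prog : seq instr) : nat := size prog.

(* The entry (i, j) of A is found at address out i j of the final memory. *)
Definition computes (n : nat) (prog : seq instr) (out : 'I_n -> 'I_n -> nat)
    (inputs : seq F) (A : 'M[F]_n) : Prop :=
  exists2 mem, run prog inputs = Some mem
    & forall i j : 'I_n, onth mem (out i j) = Some (A i j).

(* The constant Q_0, alpha_k and delta_k for 1 <= k < n, beta_k and gamma_k for
   2 <= k < n. *)
Definition recurrence_data (n : nat) (alpha beta gamma delta : nat -> F)
    (q0 : F) : seq F :=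
  q0 :: [seq alpha k | k <- iota 1 n.-1] ++ [seq delta k | k <- iota 1 n.-1]
     ++ [seq beta k | k <- iota 2 n.-2] ++ [seq gamma k | k <- iota 2 n.-2].

End StraightLinePrograms.

(* Main.v *)
Require Import Defs.
From mathcomp Require Import all_boot all_order all_algebra.
From mathcomp Require Import reals complex.
From mathcomp Require Import zify.

Set Implicit Arguments.
Unset Strict Implicit.
Unset Printing Implicit Defensive.

Import GRing.Theory.
Local Open Scope ring_scope.

(** Under the identification of a polynomial modulo X^n with its column of n
coefficients, multiplication by X is the lower shift Z0: truncation is
compatible with it because X^n generates an ideal.  Hence a X + c acts as
a Z0 + c I ([mul_affine_coef_col]), and the matrix recurrence is the image of
the recurrence between the Q_k.

For the operation count, the matrix recurrence read entrywise says
  s(k,i) = alpha_k s(k-1,i-1) - delta_k s(k-1,i)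
           - (beta_k s(k-2,i-1) + gamma_k s(k-2,i)),
which is seven operations for each of the (n-1) n entries outside column 0.
To make every entry obey this same formula, the table is padded with a zero
column Q_(-1) = 0 and a zero row i = -1, and beta_1 and gamma_1 are taken to be
zero ([padded_rec]).  All these padding values, as well as the entries below
the diagonal of column 0, live in one memory cell holding the constant 0.  The
program creates that cell, then fills the table column by column with one
block of seven instructions per entry, so that every address is an explicit
function of the position in the table.  [run_table_prog] is the loop invariant;
the total cost is 7 (n-1) n + 1, which is at most 7 n^2. *)

(** * Multiplication by X as a shift of coefficient columns *)

Section ColumnRecurrence.
Variable F : fieldType.

Lemma coef_affineM (a c : F) (q : {poly F}) i :
  ((a *: 'X + c%:P) * q)`_i = a * ('X * q)`_i + c * q`_i.
Proof. by rewrite mulrDl -scalerAl coefD coefZ coefCM. Qed.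

Definition coef_col n (q : {poly F}) : 'cV[F]_n := \col_i q`_i.

Lemma col_S_PQ n (Q : nat -> {poly F}) (j : 'I_n) :
  col j (S_PQ n Q) = coef_col n (Q j).
Proof. by apply/colP => i; rewrite !mxE. Qed.

Lemma mul_Z0_coef_col n (q : {poly F}) :
  Z0 F n *m coef_col n q = coef_col n ('X * q).
Proof.
apply/colP => -[i lt_in]; rewrite !mxE coefXM /=.
case: i lt_in => [|i] lt_in /=.
  by apply: big1 => k _; rewrite !mxE mul0r.
rewrite (bigD1 (Ordinal (ltnW lt_in))) //= !mxE eqxx mul1r big1 ?addr0 // => k.
rewrite -val_eqE /= !mxE /= eqSS eq_sym => /negPf ->.
by rewrite mul0r.
Qed.

Lemma mul_affine_coef_col n (a c : F) (q : {poly F}) :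
  (a *: Z0 F n + c%:M) *m coef_col n q
    = coef_col n ((a *: 'X + c%:P) * q).
Proof.
rewrite mulmxDl -scalemxAl mul_Z0_coef_col mul_scalar_mx.
by apply/colP => i; rewrite !mxE coef_affineM.
Qed.

Lemma mul_affineB_coef_col n (a c : F) (q : {poly F}) :
  (a *: Z0 F n - c%:M) *m coef_col n q
    = coef_col n ((a *: 'X - c%:P) * q).
Proof. by rewrite -polyCN -mul_affine_coef_col raddfN. Qed.

Lemma coef_colB n (p q : {poly F}) :
  coef_col n (p - q) = coef_col n p - coef_col n q.
Proof. by apply/colP => i; rewrite !mxE coefB. Qed.

End ColumnRecurrence.

(** * Execution of straight-line programs *)

Section StraightLinePrograms.
Variable F : fieldType.
Implicit Types (mem : seq F) (prog : seq (instr F)).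

Lemma run_cat prog1 prog2 mem :
  run (prog1 ++ prog2) mem = obind (run prog2) (run prog1 mem).
Proof.
by elim: prog1 mem => [|op prog IH] mem //=; case: exec => [v|] /=.
Qed.

(** Memory only grows at its end, so every read that succeeds once gives the
same value for ever. *)
Lemma onth_catl (s t : seq F) a x : onth s a = Some x -> onth (s ++ t) a = Some x.
Proof. by elim: s a => [|y s IH] [|a] //= /IH. Qed.

Lemma onth_size_cat (s t : seq F) a : onth (s ++ t) (size s + a) = onth t a.
Proof. by elim: s. Qed.

Lemma onth_mkseq (f : nat -> F) m k a :
  (a < k)%N -> onth [seq f i | i <- iota m k] a = Some (f (m + a)%N).
Proof.
elim: k m a => [|k IH] m [|a] //=; first by rewrite addn0.
by rewrite ltnS => /IH ->; rewrite addSnnS.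
Qed.

Lemma run_arith o a b x y v prog mem t :
  onth (mem ++ t) a = Some x -> onth (mem ++ t) b = Some y ->
  apply_op o x y = Some v ->
  run (Arith F o a b :: prog) (mem ++ t) = run prog (mem ++ rcons t v).
Proof. by move=> /= -> -> ->; rewrite -rcons_cat. Qed.

(** The instructions that compute one entry when started on a memory of size b:
a, d, be, g are the addresses of the four coefficients of the recurrence and
x, y, z, w those of the entries that they multiply.  Intermediate results are
read back at b, ..., b + 5, and the entry itself lands at b + 6. *)
Definition step_block (b a d be g x y z w : nat) : seq (instr F) :=
  [:: Arith F Mul a x; Arith F Mul d y; Arith F Defs.Sub (b + 0) (b + 1);
      Arith F Mul be z; Arith F Mul g w; Arith F Add (b + 3) (b + 4);
      Arith F Defs.Sub (b + 2) (b + 5)].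

Lemma run_step_block mem b a d be g x y z w va vd vbe vg vx vy vz vw :
  b = size mem ->
  onth mem a = Some va -> onth mem d = Some vd ->
  onth mem be = Some vbe -> onth mem g = Some vg ->
  onth mem x = Some vx -> onth mem y = Some vy ->
  onth mem z = Some vz -> onth mem w = Some vw ->
  exists t, [/\ run (step_block b a d be g x y z w) mem = Some (mem ++ t),
                size t = 7%N &
                onth t 6 = Some (va * vx - vd * vy - (vbe * vz + vg * vw))].
Proof.
move=> bE Ha Hd Hbe Hg Hx Hy Hz Hw.
exists [:: va * vx; vd * vy; va * vx - vd * vy; vbe * vz; vg * vw;
           vbe * vz + vg * vw; va * vx - vd * vy - (vbe * vz + vg * vw)].
(* The operands of a product come from the old memory [mem], those of a sum or
   a difference from the part appended by the block. *)
split=> //; rewrite -{1}[mem]cats0 /step_block.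
do 2![erewrite run_arith; [|by apply: onth_catl; eassumption..|by []]].
erewrite run_arith; [|by rewrite bE onth_size_cat..|by []].
do 2![erewrite run_arith; [|by apply: onth_catl; eassumption..|by []]].
by do 2![erewrite run_arith; [|by rewrite bE onth_size_cat..|by []]].
Qed.

End StraightLinePrograms.

(** * The program filling the table of coefficients *)

Section Program.
Variables (F : fieldType) (n : nat).

(** The number of inputs, hence the address of the first value computed by the
program, which is the constant 0. *)
Definition zero_addr : nat := (1 + (n.-1 + (n.-1 + (n.-2 + n.-2))))%N.

(** Both indices are shifted by one to make room for the zero padding: (j, i)
stands for the coefficient of degree i - 1 of Q_(j-1).  The pair (1, 1) is the
input Q_0; the other entries of column 1 vanish since Q_0 is constant.  Each
later entry is the last of the seven values appended by its block. *)
Definition entry_addr (j i : nat) : nat :=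
  match j, i with
  | 1, 1 => 0
  | j'.+2, i'.+1 => zero_addr + 7 * (j' * n + i').+1
  | _, _ => zero_addr
  end%N.

(** The argument k is the index of the recurrence coefficient minus one.  As the
inputs beta and gamma start at index 2, k = 0 is sent to the zero cell. *)
Definition alpha_addr k := (1 + k)%N.
Definition delta_addr k := (1 + (n.-1 + k))%N.
Definition beta_addr k :=
  if k is k'.+1 then (1 + (n.-1 + (n.-1 + k')))%N else zero_addr.
Definition gamma_addr k :=
  if k is k'.+1 then (1 + (n.-1 + (n.-1 + (n.-2 + k'))))%N else zero_addr.

(** The table is filled in the order of m = k n + i, where m stands for the
coefficient of degree i of Q_(k+1). *)
Definition entry_block (m : nat) : seq (instr F) :=
  let k := (m %/ n)%N in let i := (m %% n)%N in
  step_block F (zero_addr + 7 * m).+1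
    (alpha_addr k) (delta_addr k) (beta_addr k) (gamma_addr k)
    (entry_addr k.+1 i) (entry_addr k.+1 i.+1)
    (entry_addr k i) (entry_addr k i.+1).

Definition table_prog (m : nat) : seq (instr F) :=
  Const 0 :: flatten [seq entry_block l | l <- iota 0 m].

Lemma table_progS m : table_prog m.+1 = table_prog m ++ entry_block m.
Proof.
by rewrite /table_prog -addn1 iotaD map_cat flatten_cat.
Qed.

Lemma size_table_prog m : size (table_prog m) = (7 * m).+1.
Proof.
elim: m => [|m IH] //; rewrite table_progS size_cat IH /=; lia.
Qed.

Variables (alpha beta gamma delta : nat -> F) (Q : nat -> {poly F}).
Hypothesis n_gt0 : (0 < n)%N.
Hypothesis wfQ : well_free n alpha beta gamma delta Q.

Definition padded_poly (j : nat) : {poly F} := if j is j'.+1 then Q j' else 0.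

(** The factor X shifts degrees by one, which puts a zero in row 0. *)
Definition padded (j i : nat) : F := ('X * padded_poly j)`_i.

Lemma paddedSS j i : padded j.+1 i.+1 = (Q j)`_i.
Proof. by rewrite /padded coefXM. Qed.

Definition beta0 k := if k is 0%N then 0 else beta k.+1.
Definition gamma0 k := if k is 0%N then 0 else gamma k.+1.

(** The padding merges the first step of the recurrence, which has two terms
only, with the later ones, and spares the rows of degree 0 a special case. *)
Lemma padded_rec k i : (k.+1 < n)%N ->
  padded k.+2 i.+1 =
    alpha k.+1 * padded k.+1 i - delta k.+1 * padded k.+1 i.+1
    - (beta0 k * padded k i + gamma0 k * padded k i.+1).
Proof.
move=> lt_kn; case: wfQ => _ Q1E QkE.
have coefE (c : F) (q : {poly F}) : c * q`_i = c * ('X * q)`_i.+1 by rewrite coefXM.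
rewrite paddedSS /padded -!coefE /=.
case: k lt_kn => [|k] lt_kn.
  by rewrite Q1E //= -polyCN coef_affineM /= !mul0r !mulNr addr0 subr0.
by rewrite QkE //= -polyCN coefB !coef_affineM mulNr.
Qed.

Let inputs := recurrence_data n alpha beta gamma delta (Q 0%N)`_0.

Lemma size_inputs : size inputs = zero_addr.
Proof. by rewrite /inputs /= !size_cat !size_map !size_iota. Qed.

Lemma read_zero : onth (rcons inputs 0) zero_addr = Some 0.
Proof. by rewrite -cats1 -size_inputs -[size inputs]addn0 onth_size_cat. Qed.

Lemma read_params k : (k.+1 < n)%N ->
  [/\ onth (rcons inputs 0) (alpha_addr k) = Some (alpha k.+1),
      onth (rcons inputs 0) (delta_addr k) = Some (delta k.+1),
      onth (rcons inputs 0) (beta_addr k) = Some (beta0 k) &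
      onth (rcons inputs 0) (gamma_addr k) = Some (gamma0 k)].
Proof.
move=> lt_kn.
have skip f m l (t : seq F) a :
    onth ([seq f i | i <- iota m l] ++ t) (l + a)%N = onth t a.
  by rewrite -[X in (X + a)%N](size_iota m) -(size_map f) onth_size_cat.
have liftE a x : onth inputs a = Some x -> onth (rcons inputs 0) a = Some x.
  by rewrite -cats1; apply: onth_catl.
split.
- by apply: liftE => /=; apply: onth_catl; rewrite onth_mkseq ?add1n //; lia.
- apply: liftE => /=; rewrite skip; apply: onth_catl.
  by rewrite onth_mkseq ?add1n //; lia.
- case: k lt_kn => [|k] lt_kn; first exact: read_zero.
  apply: liftE => /=; rewrite !skip.
  by apply: onth_catl; rewrite onth_mkseq ?add2n //; lia.
- case: k lt_kn => [|k] lt_kn; first exact: read_zero.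
  apply: liftE => /=; rewrite !skip.
  by rewrite onth_mkseq ?add2n //; lia.
Qed.

(** These entries are known before the first block runs. *)
Lemma read_boundary j i : (j <= 1)%N || (i == 0)%N ->
  onth (rcons inputs 0) (entry_addr j i) = Some (padded j i).
Proof.
have zero_entry : entry_addr j i = zero_addr -> padded j i = 0 ->
    onth (rcons inputs 0) (entry_addr j i) = Some (padded j i).
  by move=> -> ->; exact: read_zero.
case: j i zero_entry => [|[|j]] [|[|i]] zero_entry // _;
  try by apply: zero_entry; rewrite // /padded ?mulr0 ?coef0 ?coefXM.
  by rewrite paddedSS.
apply: zero_entry => //; rewrite paddedSS nth_default //.
by case: wfQ => -> //.
Qed.

(** The invariant of the filling loop.  It is inductive because block m reads,
besides inputs and padding, only entries of the two previous columns, whose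
blocks are numbered below m. *)
Lemma run_table_prog m : (m <= n.-1 * n)%N ->
  exists mem,
    [/\ run (table_prog m) inputs = Some mem,
        size mem = (zero_addr + 7 * m).+1,
        forall a x, onth (rcons inputs 0) a = Some x -> onth mem a = Some x
      & forall k i, (i < n)%N -> (k * n + i < m)%N ->
          onth mem (entry_addr k.+2 i.+1) = Some (padded k.+2 i.+1)].
Proof.
elim: m => [|m IH] le_m.
  exists (rcons inputs 0); split=> //.
  by rewrite size_rcons size_inputs muln0 addn0.
have [mem [run_m size_mem keep done_m]] := IH (ltnW le_m).
set k := (m %/ n)%N; set i := (m %% n)%N.
have mE : m = (k * n + i)%N := divn_eq m n.
have lt_in : (i < n)%N by rewrite ltn_mod.
have lt_kn : (k.+1 < n)%N.
  have : (k < n.-1)%N by rewrite ltn_divLR.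
  lia.
have [ra rd rb rg] := read_params lt_kn.
have read j l : (j <= k.+1)%N -> (l <= n)%N ->
    onth mem (entry_addr j l) = Some (padded j l).
  case: j => [|[|j]] le_j; try by move=> _; apply/keep/read_boundary.
  case: l => [|l] lt_ln; first exact/keep/read_boundary.
  by apply: done_m => //; nia.
have [t [run_t size_t last_t]] :=
  run_step_block (esym size_mem) (keep _ _ ra) (keep _ _ rd) (keep _ _ rb)
    (keep _ _ rg) (read _ _ (leqnn _) (ltnW lt_in)) (read _ _ (leqnn _) lt_in)
    (read _ _ (leqnSn _) (ltnW lt_in)) (read _ _ (leqnSn _) lt_in).
exists (mem ++ t); split.
- by rewrite table_progS run_cat run_m.
- by rewrite size_cat size_mem size_t; lia.
- by move=> a x /keep; apply: onth_catl.
- move=> k' i' lt_i'n; rewrite ltnS leq_eqVlt => /orP[/eqP eq_m|lt_m].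
    have [-> ->] : k' = k /\ i' = i.
      by rewrite /k /i -eq_m divnMDl // divn_small // addn0 modnMDl modn_small.
    rewrite padded_rec // -last_t -(onth_size_cat mem t) size_mem.
    by congr onth; rewrite [LHS]/= -mE; lia.
  by apply: onth_catl; apply: done_m.
Qed.

Lemma computes_table_prog :
  computes (table_prog (n.-1 * n)) (fun i j => entry_addr j.+1 i.+1)
    inputs (S_PQ n Q).
Proof.
have [mem [run_mem _ keep done_mem]] := run_table_prog (leqnn _).
exists mem => // i [[|j] lt_jn]; rewrite mxE -paddedSS.
  exact/keep/(@read_boundary 1 i.+1).
apply: done_mem => //; have := ltn_ord i; nia.
Qed.

End Program.

Theorem lemma5p3 (R : realType) :
  (forall (n : nat) (alpha beta gamma delta : nat -> R[i])
          (Q : nat -> {poly R[i]}),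
      (0 < n)%N -> well_free n alpha beta gamma delta Q ->
      (forall j0 j1 : 'I_n, j0 = 0%N :> nat -> j1 = 1%N :> nat ->
         col j1 (S_PQ n Q) =
           (alpha 1%N *: Z0 R[i] n - (delta 1%N)%:M) *m col j0 (S_PQ n Q))
      /\
      (forall (k : nat) (u v w : 'I_n), (2 <= k)%N ->
         w = k :> nat -> v = k.-1 :> nat -> u = k.-2 :> nat ->
         col w (S_PQ n Q) =
           (alpha k *: Z0 R[i] n - (delta k)%:M) *m col v (S_PQ n Q)
           - (beta k *: Z0 R[i] n + (gamma k)%:M) *m col u (S_PQ n Q)))
  /\
  (exists c : nat, forall n : nat, (0 < n)%N ->
     exists (prog : seq (instr R[i])) (out : 'I_n -> 'I_n -> nat),
       (op_count prog <= c * n ^ 2)%N /\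
       forall (alpha beta gamma delta : nat -> R[i]) (Q : nat -> {poly R[i]}),
         well_free n alpha beta gamma delta Q ->
         computes prog out
           (recurrence_data n alpha beta gamma delta (Q 0%N)`_0) (S_PQ n Q)).
Proof.
split=> [n alpha beta gamma delta Q n_gt0 [_ Q1E QkE]|].
  split=> [j0 j1 j0E j1E|k u v w k_ge2 wE vE uE].
    rewrite !col_S_PQ j0E j1E mul_affineB_coef_col Q1E //.
    by rewrite -j1E.
  rewrite !col_S_PQ wE vE uE mul_affineB_coef_col mul_affine_coef_col.
  by rewrite -coef_colB QkE // k_ge2 -wE /=.
exists 7%N => n n_gt0.
exists (table_prog R[i] n (n.-1 * n)), (fun i j => entry_addr n j.+1 i.+1).
split; first by rewrite /op_count size_table_prog; nia.
by move=> alpha beta gamma delta Q; apply: computes_table_prog.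
Qed.
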